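(* Let $n\ge 2$ and let $\{D_I\}_{I\in\binom{[n]}{2}}$ be a family of positive real numbers (write $D_{i,j}=D_{\{i,j\}}$). Let $x,y\in[n]$ be such that $D_{x,y}=\max_{i,j\in[n]}D_{i,j}$. Then the family is snakelike if and only if $D_{i,j}=|D_{i,x}-D_{j,x}|$ for all distinct $i,j\in[n]\setminus\{x\}$.
   Context: A snake is a tree with exactly two leaves. A positive-weighted tree $\mathcal T=(T,w)$ has $w:E(T)\to\mathbb R_{>0}$, and for distinct vertices $i,j$, $D_{i,j}(\mathcal T)$ is the sum of the weights of the edges of the unique path from $i$ to $j$. The family $\{D_I\}$ is snakelike if there is a positive-weighted snake $\mathcal S=(S,w)$ with $V(S)=[n]$ such that $D_{i,j}(\mathcal S)=D_{i,j}$ for all distinct $i,j\in[n]$. *)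

(* Defs.v *)
From HB Require Import structures.
From mathcomp Require Import all_boot all_order all_algebra.
From mathcomp Require Import reals.

Set Implicit Arguments.
Unset Strict Implicit.
Unset Printing Implicit Defensive.

Import Order.TTheory GRing.Theory Num.Theory.
Local Open Scope ring_scope.

Section Trees.
Variable V : finType.

(* The vertices of the path are those of [i :: p]. *)
Definition simple_path (e : rel V) (i j : V) (p : seq V) : bool :=
  [&& path e i p, last i p == j & uniq (i :: p)].

(* A cyclic sequence of one or two distinct vertices is not a graph cycle. *)
Definition acyclic (e : rel V) : Prop :=
  forall c : seq V, uniq c -> cycle e c -> (size c < 3)%N.

Record tree : Type := Tree {
  adj : rel V;
  adj_sym : symmetric adj;
  adj_irrefl : irreflexive adj;
  tree_nonempty : (0 < #|V|)%N;
  tree_connected : forall i j : V, exists p : seq V, simple_path adj i j p;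
  tree_acyclic : acyclic adj }.

Definition edges (T : tree) : {set {set V}} :=
  [set [set a.1; a.2] | a : V * V & adj T a.1 a.2].

Definition degree (T : tree) (v : V) : nat := #|[set u | adj T v u]|.

Definition leaves (T : tree) : {set V} := [set v | degree T v == 1%N].

Definition snake (T : tree) : Prop := #|leaves T| = 2%N.

(* The simple path chosen here is the only one, since [T] is acyclic. *)
Definition tree_path (T : tree) (i j : V) : seq V :=
  xchoose (tree_connected T i j).

Definition path_edges (i : V) (p : seq V) : seq {set V} :=
  pairmap (fun u v => [set u; v]) i p.

End Trees.

(* [weight] is relevant only on [edges]; its other values are never used. *)
Record pwtree (R : realType) (V : finType) : Type := PWTree {
  pwtree_tree :> tree V;
  weight : {set V} -> R;
  weight_gt0 : forall I : {set V}, I \in edges pwtree_tree -> 0 < weight I }.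

Definition tree_dist (R : realType) (V : finType) (T : pwtree R V) (i j : V) : R :=
  \sum_(I <- path_edges i (tree_path T i j)) weight T I.

(* A family indexed by the 2-subsets of [n] is given by a function on all
   subsets, of which only the values at 2-subsets are used. *)
Definition snakelike (R : realType) (n : nat) (D : {set 'I_n} -> R) : Prop :=
  exists S : pwtree R 'I_n,
    snake S /\
    forall i j : 'I_n, i != j -> tree_dist S i j = D [set i; j].

(* Main.v *)
Require Import Defs.
From HB Require Import structures.
From mathcomp Require Import all_boot all_order all_algebra.
From mathcomp Require Import reals.
From mathcomp Require Import zify lra.

Set Implicit Arguments.
Unset Strict Implicit.
Unset Printing Implicit Defensive.

Import Order.TTheory GRing.Theory Num.Theory.
Local Open Scope ring_scope.

(** A tree is a snake exactly when one simple path visits every vertex: every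
    simple path from a leaf [a] extends to a maximal one, which ends in the only
    other leaf, and simple paths in a tree are unique.  Along such a path the
    tree metric is [|f i - f j|] with [f] the distance to [a]; maximality of
    [D_{x,y}] puts [x] and [y] at the two ends, which gives the equations.
    Conversely, the equations say that [D_{i,j} = |f i - f j|] with
    [f i = D_{i,x}] and [f x = 0], and joining vertices that are consecutive for
    [f] gives the snake, with the restriction of [D] as weight. *)

(** * Simple paths in an acyclic graph *)

Section SimplePaths.
Variables (V : finType) (e : rel V).

Lemma simple_path_cat a b p1 p2 :
  simple_path e a b (p1 ++ p2) ->
  simple_path e a (last a p1) p1 /\ simple_path e (last a p1) b p2.
Proof.
rewrite /simple_path cat_path last_cat -cat_cons cat_uniq.
case/and3P=> /andP[-> p2P] -> /and3P[-> no p2U]; rewrite p2P eqxx /= p2U andbT.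
split=> //; apply: contra no => lp2; apply/hasP.
by exists (last a p1); rewrite // mem_last.
Qed.

(** The two cases are the two orders in which [i] and [j] can occur along the path; keeping the
    longer prefix as [q1 ++ q2] lets distances be added. *)
Lemma simple_path_split a b p i j :
  simple_path e a b p -> i \in a :: p -> j \in a :: p ->
  (exists q1 q2, [/\ simple_path e a i q1, simple_path e i j q2
                   & simple_path e a j (q1 ++ q2)]) \/
  (exists q1 q2, [/\ simple_path e a j q1, simple_path e j i q2
                   & simple_path e a i (q1 ++ q2)]).
Proof.
move=> pP ip; case/splitPl: p / ip pP => p1 p2 <- {i} pP.
have [p1P p2P] := simple_path_cat pP.
rewrite -cat_cons mem_cat => /orP[jp1|jp2].
  right; case/splitPl: p1 / jp1 p1P {pP p2P} => q1 q2 <- {j} p1P.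
  by have [q1P q2P] := simple_path_cat p1P; exists q1, q2; rewrite last_cat in p1P q2P *.
left; have /splitPl jp : j \in last a p1 :: p2 by rewrite inE jp2 orbT.
case: jp pP p2P => q1 q2 <- {j jp2}; rewrite catA => pP p2P.
have [q1P _] := simple_path_cat p2P; have [qP _] := simple_path_cat pP.
by exists p1, q1; rewrite last_cat in qP.
Qed.

Hypothesis e_sym : symmetric e.

Lemma simple_path_rev i j p :
  simple_path e i j p -> simple_path e j i (rev (belast i p)).
Proof.
case/and3P=> pP /eqP <- pU; apply/and3P; split.
- by rewrite rev_path (eq_path (e' := e)) // => u v; rewrite e_sym.
- by case: p {pP pU} => //= u p; rewrite rev_cons last_rcons.
- by rewrite -rev_rcons -lastI rev_uniq.
Qed.

Hypothesis e_acyclic : acyclic e.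

(** If two simple paths left [i] through distinct neighbours [u] and [v], following one to [j] and
    the other back would give a walk from [u] to [v] avoiding [i]; once shortened, it closes at [i]
    into a cycle. *)
Lemma simple_path_unique i j p q :
  simple_path e i j p -> simple_path e i j q -> p = q.
Proof.
elim: p i q => [|u p IHp] i [|v q] //.
- by move=> /and3P[_ /= /eqP <- _] /and3P[_ /= /eqP <-]; rewrite mem_last.
- by move=> /and3P[_ /= /eqP <- +] /and3P[_ /= /eqP qi _]; rewrite qi mem_last.
move=> pP qP.
have [_ p'P] := @simple_path_cat i j [:: u] p pP.
have [_ q'P] := @simple_path_cat i j [:: v] q qP.
have [uv|uv] := eqVneq u v; first by rewrite uv (IHp v q) // -uv.
have /and3P[q'rP /eqP q'rl _] := simple_path_rev q'P.
case/and3P: p'P => p'P /eqP p'l _.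
have rP : path e u (p ++ rev (belast v q)) by rewrite cat_path p'P p'l.
have rl : last u (p ++ rev (belast v q)) = v by rewrite last_cat p'l.
have ir : i \notin u :: p ++ rev (belast v q).
  rewrite -cat_cons mem_cat mem_rev; apply/norP; split.
    by case/and3P: pP => _ _ /andP[].
  apply/negP => /mem_belast iq.
  by case/and3P: qP => _ _ /andP[/negP[]].
case: (shortenP rP) rl => r' r'P r'U sub r'l.
have := e_acyclic (c := i :: u :: r').
rewrite /= rcons_path r'l r'P.
have -> : e i u by case/and3P: pP => /andP[].
have -> : e v i by rewrite e_sym; case/and3P: qP => /andP[].
move: r'U => /= ->; rewrite inE negb_or.
move: (ir); rewrite inE => /norP[-> /= ir'] /=.
have -> : i \notin r' by apply: contra ir' => /sub.
(* Since [u] and [v] differ, [r'] is nonempty and the cycle has at least three vertices. *)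
move/(_ isT isT); case: r' r'l {r'P sub} => //= /eqP.
by rewrite (negPf uv).
Qed.

Hypothesis e_irr : irreflexive e.

(** A neighbour of [l] on the path other than its predecessor would close a cycle with the stretch
    of path between them. *)
Lemma maximal_path_end_degree a l p :
  simple_path e a l p -> p != [::] ->
  (forall z, e l z -> z \in a :: p) -> #|[set u | e l u]| = 1%N.
Proof.
case/lastP: p => // p l' /and3P[+ + +] _.
rewrite rcons_path last_rcons => /andP[pP el] /eqP ?; subst l' => pU nbr.
apply/eqP/cards1P; exists (last a p); apply/setP=> z; rewrite !inE.
apply/idP/eqP=> [lz|->]; last by rewrite e_sym.
have := nbr z lz; rewrite -rcons_cons mem_rcons inE.
case/orP=> [/eqP zl|zp]; first by rewrite zl e_irr in lz.
case/splitPl: p / zp pP el pU {nbr} => p1 p2 zE.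
rewrite cat_path last_cat zE => /andP[_ p2P] el.
rewrite rcons_cat -cat_cons lastI zE cat_rcons cat_uniq.
case/and3P=> _ _ cU.
have := e_acyclic (c := z :: rcons p2 l) cU.
rewrite /= !rcons_path last_rcons p2P el lz size_rcons => /(_ isT).
by case: p2 {p2P el cU}.
Qed.

(** Neighbours off the path are appended until none remains. A simple path has at most [#|V|]
    vertices, so [#|V| - size p] strictly decreases. *)
Lemma simple_path_extend_to_leaf a w p :
  simple_path e a w p -> p != [::] ->
  exists l q, simple_path e a l (p ++ q) /\ #|[set u | e l u]| = 1%N.
Proof.
have [k le_k] := ubnP (#|V| - size p)%N.
elim: k w p le_k => // k IHk w p le_k pP pn0.
have [/existsP[z /andP[wz zp]]|/existsPn nbr] :=
  boolP [exists z, e w z && (z \notin a :: p)]; last first.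
  exists w, [::]; rewrite cats0; split=> //.
  apply: maximal_path_end_degree pP pn0 _ => z wz.
  by have := nbr z; rewrite wz negbK.
have /and3P[pE /eqP pw pU] := pP.
have zU : uniq (a :: rcons p z) by rewrite -rcons_cons rcons_uniq zp.
have zP : simple_path e a z (rcons p z).
  by rewrite /simple_path zU rcons_path pE pw wz last_rcons eqxx.
have size_p : (size p < #|V|)%N.
  by have := max_card (mem (a :: p)); rewrite (card_uniqP pU).
have [||l [q [qP ql]]] := IHk z (rcons p z) _ zP.
- by rewrite size_rcons; lia.
- by case: (p).
by exists l, (z :: q); rewrite -cat_rcons.
Qed.

End SimplePaths.

(** * A snake is spanned by the path between its leaves *)

Section Snakes.
Variables (V : finType) (T : tree V).

Lemma tree_path_simple i j : simple_path (adj T) i j (tree_path T i j).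
Proof. exact: xchooseP. Qed.

Lemma tree_pathE i j p : simple_path (adj T) i j p -> tree_path T i j = p.
Proof.
move=> pP; apply: simple_path_unique pP => //.
- exact: adj_sym.
- exact: tree_acyclic.
- exact: tree_path_simple.
Qed.

Lemma snake_traceable :
  snake T -> exists a b, forall v, v \in a :: tree_path T a b.
Proof.
move=> /eqP/cards2P[a [b [ab leavesE]]]; exists a, b => v.
have [->|va] := eqVneq v a; first exact: mem_head.
have pP := tree_path_simple a v.
have pn0 : tree_path T a v != [::].
  by case: (tree_path T a v) pP => // /and3P[_ /= /eqP av]; rewrite av eqxx in va.
have [l [q [qP ql]]] := simple_path_extend_to_leaf
  (@adj_sym _ T) (@tree_acyclic _ T) (@adj_irrefl _ T) pP pn0.
(* A nonempty simple path from [a] cannot return to [a], so the leaf it reaches is the other one. *)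
have lb : l = b.
  have : l \in leaves T by rewrite inE; apply/eqP.
  rewrite leavesE !inE => /orP[]/eqP // la.
  case: (tree_path T a v) pn0 qP => // u p _ /and3P[_ /= /eqP ul /andP[/negP[]]].
  by rewrite -[X in X \in _]la -ul; exact: mem_last.
rewrite (tree_pathE (p := tree_path T a v ++ q)) -?lb //.
have /and3P[_ /eqP vE _] := pP.
by rewrite -cat_cons mem_cat -[X in X \in _ :: _]vE mem_last.
Qed.

End Snakes.

(** * Distances along a spanning path *)

Section TreeDistance.
Variables (R : realType) (V : finType) (T : pwtree R V).

Lemma tree_distE i j p : simple_path (adj T) i j p ->
  tree_dist T i j = \sum_(I <- path_edges i p) weight T I.
Proof. by rewrite /tree_dist => /tree_pathE ->. Qed.

Lemma tree_dist_ge0 i j : 0 <= tree_dist T i j.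
Proof.
rewrite /tree_dist; have /and3P[+ _ _] := tree_path_simple T i j.
move: (tree_path T i j) => q; elim: q i => [|u p IHp] v /=; first by rewrite big_nil.
case/andP=> vu /IHp up; rewrite big_cons addr_ge0 // ltW // weight_gt0 //.
by apply/imsetP; exists (v, u); rewrite ?inE.
Qed.

Lemma tree_dist_cat i j k p q :
  simple_path (adj T) i j p -> simple_path (adj T) j k q ->
  simple_path (adj T) i k (p ++ q) ->
  tree_dist T i k = tree_dist T i j + tree_dist T j k.
Proof.
move=> pP qP pqP; rewrite (tree_distE pP) (tree_distE qP) (tree_distE pqP).
by case/and3P: pP => _ /eqP <- _; rewrite /path_edges pairmap_cat big_cat.
Qed.

Lemma tree_distC i j : tree_dist T i j = tree_dist T j i.
Proof.
have := tree_path_simple T i j; move: (tree_path T i j) => q qP.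
rewrite (tree_distE qP) (tree_distE (simple_path_rev (@adj_sym _ T) qP)).
case/and3P: qP => _ /eqP <- _.
elim: q i => [|u p IHp] v //=.
rewrite rev_cons -cats1 /path_edges pairmap_cat big_cat big_cons /= big_seq1.
rewrite -!/(path_edges _ _) IHp.
have -> : last (last u p) (rev (belast u p)) = u.
  by case: p {IHp} => //= w p; rewrite rev_cons last_rcons.
by rewrite addrC setUC.
Qed.

(** Of [i] and [j], the one met later lies on the path from [a] beyond the other, so its distance to
    [a] exceeds the other's by the distance between them. *)
Lemma traceable_tree_dist a b p :
  simple_path (adj T) a b p -> (forall v, v \in a :: p) ->
  forall i j, tree_dist T i j = `|tree_dist T a i - tree_dist T a j|.
Proof.
move=> pP p_all i j.
have d_ge0 := tree_dist_ge0 i j.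
case: (simple_path_split pP (p_all i) (p_all j)) => [] [q1 [q2 [q1P q2P qP]]];
  rewrite (tree_dist_cat q1P q2P qP) ?(tree_distC j i).
- by rewrite opprD addNKr normrN ger0_norm.
- by rewrite addrAC subrr add0r ger0_norm.
Qed.

End TreeDistance.

(** * The path graph of an enumeration of the vertices *)

Section PathTree.
Variables (V : finType) (a : V) (p : seq V).
Hypotheses (s_uniq : uniq (a :: p)) (s_all : forall v, v \in a :: p).
Local Notation s := (a :: p).

Definition consecutive : rel V := fun u v =>
  (index v s == (index u s).+1) || (index u s == (index v s).+1).

Lemma consecutive_sym : symmetric consecutive.
Proof. by move=> u v; rewrite /consecutive orbC. Qed.

Lemma consecutive_irrefl : irreflexive consecutive.
Proof. by move=> u; rewrite /consecutive; lia. Qed.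

Lemma consecutive_spanning : simple_path consecutive a (last a p) p.
Proof.
rewrite /simple_path eqxx s_uniq !andbT; apply/(pathP a) => i ip.
by rewrite /consecutive -[nth a p i]/(nth a s i.+1) !index_uniq ?eqxx // ltnW.
Qed.

Lemma consecutive_connected i j : exists q, simple_path consecutive i j q.
Proof.
case: (simple_path_split consecutive_spanning (s_all i) (s_all j)).
  by case=> q1 [q2 [_ q2P _]]; exists q2.
case=> q1 [q2 [_ q2P _]]; exists (rev (belast j q2)).
exact: (simple_path_rev consecutive_sym q2P).
Qed.

(* Both cyclic neighbours of a vertex of maximal index would have to be its
   predecessor in [s]. *)
Lemma consecutive_acyclic : acyclic consecutive.
Proof.
move=> c cU cP; rewrite ltnNge; apply/negP => c_size.
have [m0 m0c] : exists m0, m0 \in c.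
  by case: c c_size {cU cP} => // m0 c; exists m0; exact: mem_head.
have [m mc m_max] := @arg_maxnP _ m0 (mem c) (fun v => index v s) m0c.
have [k c' rotE] := rot_to mc.
move: cU cP c_size; rewrite -(rot_uniq k) -(rot_cycle k) -(size_rot k) rotE.
have le_m u : u \in m :: c' -> (index u s <= index m s)%N.
  by rewrite -rotE mem_rot; exact: m_max.
case: c' le_m {rotE} => [|u [|v t]] // le_m cU /=.
rewrite rcons_path => /and4P[mu _ _ wm] _; set w := last v t in wm.
have wt : w \in v :: t := mem_last v t.
have := le_m u; have := le_m w; rewrite !in_cons -in_cons wt eqxx !orbT.
move=> /(_ isT) le_w /(_ isT) le_u.
have uw : u = w.
  rewrite -(nth_index a (s_all u)) -(nth_index a (s_all w)); congr nth.
  by move: mu wm; rewrite /consecutive; lia.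
by move: cU; rewrite /= uw -/w => /and3P[_]; rewrite wt.
Qed.

Lemma card_V_gt0 : (0 < #|V|)%N.
Proof. by apply/card_gt0P; exists a. Qed.

Definition path_tree : tree V :=
  Tree consecutive_sym consecutive_irrefl card_V_gt0 consecutive_connected
    consecutive_acyclic.

Lemma index_eq_nth k u : (k < size s)%N -> (index u s == k) = (u == nth a s k).
Proof.
move=> ks; apply/eqP/eqP=> [<-|->]; first by rewrite nth_index.
exact: index_uniq.
Qed.

Lemma path_tree_snake : p != [::] -> snake path_tree.
Proof.
move=> pn0; have p_gt0 : (0 < size p)%N by case: (p) pn0.
rewrite /snake; suff -> : leaves path_tree = [set a; last a p].
  rewrite cards2; case: (p) pn0 s_uniq => //= u q _ /andP[ap _].
  by case: eqP ap => // ->; rewrite mem_last.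
have idx_last : index (last a p) s = size p.
  by rewrite (last_nth a) index_uniq.
have lt_idx u : (index u s <= size p)%N by rewrite -ltnS index_mem s_all.
apply/setP=> v; rewrite !inE /degree.
have [->|va] /= := eqVneq v a.
  apply/cards1P; exists (nth a s 1); apply/setP=> u; rewrite !inE.
  by rewrite -index_eq_nth //= /consecutive /= eqxx; case: (a =P u); lia.
(* The last vertex has index [size p], so its only neighbour is at [(size p).-1]. *)
have [->|vb] /= := eqVneq v (last a p).
  apply/cards1P; exists (nth a s (size p).-1); apply/setP=> u; rewrite !inE.
  rewrite -index_eq_nth; last by rewrite /=; lia.
  by rewrite /consecutive idx_last; have := lt_idx u; lia.
have v_gt0 : (0 < index v s)%N by rewrite lt0n index_eq_nth.
have v_lt : (index v s < size p)%N.
  by rewrite ltn_neqAle lt_idx andbT index_eq_nth ?ltnSn // -last_nth.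
apply/negbTE; rewrite neq_ltn; apply/orP; right.
set k := index v s in v_gt0 v_lt *.
(* An interior vertex has two distinct neighbours, one on each side, hence is no leaf. *)
have -> : 2%N = #|[set nth a s k.-1; nth a s k.+1]|.
  by rewrite cards2 nth_uniq //=; lia.
apply: subset_leq_card; apply/subsetP=> u; rewrite !inE => uE.
rewrite /= /consecutive -/k.
by case/orP: uE; rewrite -index_eq_nth ?[size s]/=; lia.
Qed.

End PathTree.

(** * Families given by differences of a real function *)

Lemma sum_path_edges_monotone (R : realType) (V : finType) (D : {set V} -> R)
    (f : V -> R) a p :
  (forall u v, u != v -> D [set u; v] = `|f u - f v|) ->
  uniq (a :: p) -> path (fun u v => f u <= f v) a p ->
  \sum_(I <- path_edges a p) D I = f (last a p) - f a.
Proof.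
move=> DE; elim: p a => [|u p IHp] a /=; first by rewrite big_nil subrr.
rewrite inE => /andP[/norP[au _] pU] /andP[le_au pP].
(* Monotonicity removes the absolute value, so the sum telescopes. *)
rewrite big_cons IHp // DE // distrC ger0_norm ?subr_ge0 //.
by rewrite addrC addrA subrK.
Qed.

Theorem theorem3p1 (R : realType) (n : nat) (hn : (2 <= n)%N)
    (D : {set 'I_n} -> R)
    (D_gt0 : forall I : {set 'I_n}, #|I| = 2%N -> 0 < D I)
    (x y : 'I_n) (hxy : x != y)
    (Dxy_max : forall i j : 'I_n, i != j -> D [set i; j] <= D [set x; y]) :
  snakelike D <->
  (forall i j : 'I_n, i != j -> i != x -> j != x ->
     D [set i; j] = `|D [set i; x] - D [set j; x]|).
Proof.
split.
  case=> S [/snake_traceable[a [b p_all]] DE] i j ij ix jx.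
  have dE := traceable_tree_dist (tree_path_simple S a b) p_all.
  have {}DE u v : u != v -> D [set u; v] = `|tree_dist S a u - tree_dist S a v|.
    by move=> uv; rewrite -dE DE.
  set f := tree_dist S a in DE.
  have le_max u v : `|f u - f v| <= `|f x - f y|.
    have [->|uv] := eqVneq u v; first by rewrite subrr normr0.
    by rewrite -!DE // Dxy_max.
  have := le_max i x; have := le_max i y; have := le_max j x; have := le_max j y.
  rewrite !DE //; move: (f i) (f j) (f x) (f y) => fi fj fx fy.
  (* The four bounds put [fi] and [fj] between [fx] and [fy]. Their differences with [fx] thus have
     the same sign, and [fx] cancels. *)
  case: (ger0P (fx - fy)) => ?; do 4 (rewrite ler_norml => /andP[? ?]).
    rewrite (ler0_norm (_ : fi - fx <= 0)); last by lra.
    rewrite (ler0_norm (_ : fj - fx <= 0)); last by lra.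
    by rewrite distrC; congr `|_|; lra.
  rewrite (ger0_norm (_ : 0 <= fi - fx)); last by lra.
  rewrite (ger0_norm (_ : 0 <= fj - fx)); last by lra.
  by congr `|_|; lra.
move=> DE.
(* The value at [x] is set by hand: [[set x; x]] is a singleton, where [D] is unconstrained. *)
pose f i := if i == x then 0 else D [set i; x].
have D_gt0' i j : i != j -> 0 < D [set i; j].
  by move=> ij; rewrite D_gt0 // cards2 ij.
have {}DE i j : i != j -> D [set i; j] = `|f i - f j|.
  rewrite /f; have [->|ix] := eqVneq i x; have [->|jx] := eqVneq j x => ij.
  - by [].
  - by rewrite sub0r normrN [in LHS]setUC gtr0_norm // D_gt0' // eq_sym.
  - by rewrite subr0 gtr0_norm // D_gt0'.
  - exact: DE.
(* Sorting by [f] gives the order of the vertices along the snake. *)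
pose r u v := f u <= f v.
have s_sorted : sorted r (sort r (enum 'I_n)).
  by apply: sort_sorted => u v; exact: le_total.
have s_uniq : uniq (sort r (enum 'I_n)) by rewrite sort_uniq enum_uniq.
have s_all v : v \in sort r (enum 'I_n) by rewrite mem_sort mem_enum.
have s_size : size (sort r (enum 'I_n)) = n by rewrite size_sort size_enum_ord.
case: (sort r (enum 'I_n)) s_sorted s_uniq s_all s_size => [|a p] /=.
  by move=> _ _ _ n0; rewrite -n0 in hn.
move=> p_sorted p_uniq p_all p_size.
pose T := path_tree p_uniq p_all.
have D_edges I : I \in edges T -> 0 < D I.
  case/imsetP=> -[u v] uv ->; apply: D_gt0'; apply: contraTneq uv => /= ->.
  by rewrite inE /= consecutive_irrefl.
exists (PWTree D_edges); split.
  (* As [n] is at least 2, the tail [p] is nonempty. *)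
  by apply: path_tree_snake; rewrite -size_eq0 -lt0n -ltnS p_size.
move=> i j ij; have pP := consecutive_spanning p_uniq.
rewrite (traceable_tree_dist (T := PWTree D_edges) pP p_all) DE //.
(* The path from [a] to [v] is a prefix of the sorted enumeration; the offset [f a] cancels in
   differences. *)
have dE v : tree_dist (PWTree D_edges) a v = f v - f a.
  have [q1 [q2 [pE q1l]]] : exists q1 q2, p = q1 ++ q2 /\ last a q1 = v.
    by case/splitPl: (p_all v) => q1 q2; exists q1, q2.
  have /simple_path_cat[+ _] : simple_path (adj T) a (last a p) (q1 ++ q2).
    by rewrite -pE.
  rewrite q1l => q1P.
  rewrite (tree_distE (T := PWTree D_edges) q1P) -q1l.
  apply: sum_path_edges_monotone => //; first by case/and3P: q1P.
  by move: p_sorted; rewrite pE cat_path => /andP[].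
by rewrite !dE; congr `|_|; lra.
Qed.
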